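(* Let $p > 3$ be a prime and let $m \ge 1$ be an integer. (a) Every path in $\mathcal{C}^2_p$ starting in $(mp-2,1^2)$ has initial part $$(mp-2,1^2) \longrightarrow (mp-2,2,1) \longrightarrow \cdots \longrightarrow (mp-2,p-2,1),$$ where the $j$-th vertex is $(mp-2,j,1)$ for $1 \le j \le p-2$. (b) For $m=1$, every path in $\mathcal{C}^2_p$ starting in $(p-2,1^2)$ has initial part as displayed in (a) with $m=1$ (whose last vertex is $((p-2)^2,1)$), continued by $$((p-2)^2,1) \longrightarrow ((p-2)^2,1^2) \longrightarrow (p-1,p-2,1^2).$$
   Context: $\Sigma_n$ is the symmetric group on $n$ letters. $S^\lambda_{\mathbb{Z}}$ is the integral Specht module in James' convention (the $\mathbb{Z}\Sigma_n$-submodule of the permutation module on $\lambda$-tabloids spanned by polytabloids, so $S^{(n)}_{\mathbb{Z}}$ is trivial). $\mathcal{C}^2_p := \bigcup_{n \in \mathbb{Z}_{\ge 0}} \{\lambda \vdash n \mid p \text{ divides } |H^2(\Sigma_n,S^\lambda_{\mathbb{Z}})|\}$, regarded as a directed graph with an arrow $\lambda \to \mu$ (for $\lambda,\mu \in \mathcal{C}^2_p$) exactly when $\mu$ is obtained from $\lambda$ by adding one node; then $\lambda$ is called a predecessor of $\mu$ in $\mathcal{C}^2_p$. A path in $\mathcal{C}^2_p$ is an infinite simple directed path whose start vertex has no predecessor in $\mathcal{C}^2_p$. Exponents in partitions denote repeated parts. *)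

(* Defs.v *)
From HB Require Import structures.
From mathcomp Require Import all_boot all_order all_fingroup all_algebra.
From mathcomp Require Import boolp classical_sets functions cardinality.

Set Implicit Arguments.
Unset Strict Implicit.
Unset Printing Implicit Defensive.

Import GRing.Theory.

Local Open Scope ring_scope.
Local Open Scope classical_set_scope.

(* The product of permutations in MathComp is (s * u) x = u (s x), so letters
   are permuted on the right and modules over 'S_n are right modules, as in
   James' lecture notes.  Accordingly the second cohomology group is computed
   from the inhomogeneous bar complex of a right module. *)
Section GroupCohomology.

Variables (gT : finGroupType) (V : zmodType) (to : {action gT &-> V}).
Variable W : set V.

Definition d1 (f : {ffun gT -> V}) : {ffun gT * gT -> V} :=
  [ffun x : gT * gT => f x.2 - f (x.1 * x.2)%g + to (f x.1) x.2].

Definition d2 (f : {ffun gT * gT -> V}) : {ffun gT * gT * gT -> V} :=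
  [ffun x : gT * gT * gT => let: (g, h, k) := x in
    f (h, k) - f ((g * h)%g, k) + f (g, (h * k)%g) - to (f (g, h)) k].

Definition Z2 : set {ffun gT * gT -> V} :=
  [set f : {ffun gT * gT -> V} | (forall x, W (f x)) /\ d2 f = 0].

Definition B2 : set {ffun gT * gT -> V} :=
  [set d1 f | f in [set f : {ffun gT -> V} | forall x, W (f x)]].

(* H^2(G, W) for a G-stable subgroup W of V, as the set of cosets of B2 in
   Z2. *)
Definition H2 : set (set {ffun gT * gT -> V}) :=
  [set [set f + b | b in B2] | f in Z2].

End GroupCohomology.

Definition is_part (la : seq nat) : bool := sorted geq la && (0%N \notin la).

Section Specht.

Variable la : seq nat.
Let n := sumn la.

Definition node := {i : 'I_(size la) & 'I_(nth 0%N la i)}.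
Definition noderow (c : node) : 'I_(size la) := tag c.
Definition nodecol (c : node) : nat := tagged c.

Lemma card_noderow (i : 'I_(size la)) :
  #|[pred c : node | noderow c == i]| = nth 0%N la i.
Proof.
rewrite -sum1_card -[RHS]card_ord -[RHS]sum1_card.
rewrite -[RHS](big_pred1_eq addn i (fun j => \sum_(k : 'I_(nth 0%N la j)) 1))%N.
rewrite sig_big_dep /=.
by apply: eq_bigl => c; rewrite inE andbT.
Qed.

Lemma card_node : #|{: node}| = n.
Proof.
rewrite card_tagged sumnE big_map big_enum /= /n sumnE (big_nth 0%N) big_mkord.
by apply: eq_bigr => i _; rewrite card_ord.
Qed.

(* A tableau is given by the bijection sending each letter to the node that
   it occupies, i.e. by the inverse of the usual filling. *)
Definition tableau := {t : {ffun 'I_n -> node} | injectiveb t}.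

(* A tabloid is given by the function sending each letter to its row. *)
Definition is_tabloid (r : {ffun 'I_n -> 'I_(size la)}) : bool :=
  [forall i : 'I_(size la), #|[pred x | r x == i]| == nth 0%N la i].
Definition tabloid := {r : {ffun 'I_n -> 'I_(size la)} | is_tabloid r}.

Lemma tabloid_of_subproof (t : tableau) :
  is_tabloid [ffun x => noderow (val t x)].
Proof.
apply/forallP => i; apply/eqP.
have t_inj : injective (val t) by apply/injectiveP/(valP t).
have [u tK uK] : bijective (val t).
  by apply: inj_card_bij => //; rewrite card_node card_ord.
rewrite -[RHS]card_noderow -(fintype.card_image t_inj); apply: eq_card => c.
rewrite !inE; apply/fintype.imageP/idP => [[x]|ci].
  by rewrite inE ffunE => xi ->.
by exists (u c); rewrite ?inE ?ffunE uK.
Qed.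

Definition tabloid_of (t : tableau) : tabloid :=
  Sub [ffun x => noderow (val t x)] (tabloid_of_subproof t).

Lemma tabloid_act_subproof (T : tabloid) (s : 'S_n) :
  is_tabloid [ffun x => val T (s^-1%g x)].
Proof.
apply/forallP => i; apply/eqP; rewrite -(eqP (forallP (valP T) i)).
rewrite -[RHS](fintype.card_image (@perm_inj _ s)); apply: eq_card => x.
rewrite inE ffunE; apply/idP/fintype.imageP => [xi|[y]].
  by exists (s^-1%g x); rewrite ?inE ?permKV.
by rewrite inE => yi ->; rewrite permK.
Qed.

(* T s: every letter x is replaced by s x. *)
Definition tabloid_act (T : tabloid) (s : 'S_n) : tabloid :=
  Sub [ffun x => val T (s^-1%g x)] (tabloid_act_subproof T s).

(* The permutation module: f is the linear combination of tabloids
   \sum_T f(T) T. *)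
Definition permmod := {ffun tabloid -> int}.

Definition permmod_fun (f : permmod) (s : 'S_n) : permmod :=
  [ffun T => f (tabloid_act T s^-1%g)].

Lemma permmod_fun1 : permmod_fun^~ 1%g =1 id.
Proof.
move=> f; apply/ffunP => T; rewrite ffunE; congr (f _).
by apply/val_inj/ffunP => x; rewrite ffunE !invg1 perm1.
Qed.

Lemma permmod_funM (f : permmod) : act_morph permmod_fun f.
Proof.
move=> s u; apply/ffunP => T; rewrite !ffunE; congr (f _).
by apply/val_inj/ffunP => x; rewrite !ffunE !invgK permM.
Qed.

Definition permmod_act : {action 'S_n &-> permmod} :=
  TotalAction permmod_fun1 permmod_funM.

Definition tabloid_vec (T : tabloid) : permmod := [ffun T' => (T' == T)%:R].

Definition col_stab (t : tableau) : pred 'S_n :=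
  fun s => [forall x, nodecol (val t (s x)) == nodecol (val t x)].

Definition polytabloid (t : tableau) : permmod :=
  \sum_(s | col_stab t s)
     tabloid_vec (tabloid_act (tabloid_of t) s) *~ (-1) ^+ s.

Definition specht : set permmod :=
  [set v | exists c : tableau -> int, v = \sum_t polytabloid t *~ c t].

End Specht.

Definition H2_specht (la : seq nat) := H2 (permmod_act la) (@specht la).
Arguments H2_specht la : clear implicits.

Definition C2 (p : nat) : set (seq nat) :=
  [set la | is_part la /\
            exists N : nat, (H2_specht la #= `I_N)%card /\ (p %| N)%N].

Definition C2_arrow (p : nat) (la mu : seq nat) : Prop :=
  [/\ C2 p la, C2 p mu & exists i, mu = incr_nth la i].

Definition C2_path (p : nat) (q : nat -> seq nat) : Prop :=
  [/\ forall i, C2_arrow p (q i) (q i.+1), injective q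
    & forall la, ~ C2_arrow p la (q 0%N)].

(* Main.v *)
From HB Require Import structures.
From mathcomp Require Import all_boot all_order all_fingroup all_algebra.
From mathcomp Require Import all_solvable.
From mathcomp Require Import boolp classical_sets functions cardinality.
From mathcomp Require Import zify.
Require Import Defs.

(** The theorem is a statement about p-blocks: a partition can only lie in
the graph when its Specht module has the central character of the trivial
module modulo p, and along the displayed paths this leaves a single node to
add at each step.

An element z of the centre of Z[G] acts on H^2(G, W) through its action on the
coefficients W, but also through its augmentation, the action on the trivial
module; the two agree (central_act_H2, an explicit homotopy on bar cochains).
Take for z the sum of the transpositions (x y) over all ordered pairs of
letters, a pair x = y contributing the identity.  Its augmentation is n^2, and
on the Specht module of la it is the scalar
   #(ordered pairs of nodes in the same row)
     - #(ordered pairs of distinct nodes in the same column)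
(specht_transp), which is n plus twice the sum of the contents of la.  Hence
the difference between this scalar and n^2 annihilates the cohomology group.
If p divides the order of that group, then by Cauchy's theorem p divides this
difference (C2_transp_char).

Adding to la a node of content c = la_i - i changes the scalar by 2 c + 1 and
n^2 by 2 n + 1, so for p odd an arrow out of la can only add a node whose
content is n modulo p (C2_arrow_content).  Modulo p the contents of the
other addable nodes of the partitions displayed differ from n by a residue
that is visibly nonzero, so the next vertex is forced. *)

Set Implicit Arguments.
Unset Strict Implicit.
Unset Printing Implicit Defensive.

Import GRing.Theory.

(** * Subgroups of abelian groups and the order of a quotient *)

(** Stated for a bare group law on a finite type, since the quotient to which
this is applied is only known through a bijection with an ordinal. *)
Lemma group_law_Cauchy (T : finType) (add : T -> T -> T) (zero : T)
    (opp : T -> T) (p : nat) :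
    associative add -> left_id zero add -> left_inverse zero opp add ->
    prime p -> p %| #|T| ->
  exists2 x, x <> zero & iter p (add x) zero = zero.
Proof.
move=> addA add0 addN p_pr p_dvd.
pose G : finGroupType := HB.pack (Finite.sort T)
  (@Finite_isGroup.Axioms_ _ _ _ _ _ _ _ _ addA add0 addN).
have [|x _ ox] := @Cauchy G p [set: G]%G p_pr.
  rewrite cardsT (_ : #|G| = #|T|) //.
  by apply: (@bij_eq_card G T id); exists id.
have iterE k : iter k (add x) zero = (x ^+ k)%g :> G.
  by elim: k => [|k IHk] //=; rewrite expgS -IHk.
exists x; last by rewrite iterE -ox expg_order.
by move=> x0; move: p_pr; rewrite -ox x0 (order1 G).
Qed.

Section Subgroups.
Local Open Scope ring_scope.
Local Open Scope classical_set_scope.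

Variable V : zmodType.
Implicit Types (S Z B : set V) (u v f : V).

Definition is_subgroup S := S 0 /\ forall u v, S u -> S v -> S (u - v).

Lemma subgroup_opp S u : is_subgroup S -> S u -> S (- u).
Proof. by move=> [S0 SB] Su; rewrite -sub0r; apply: SB. Qed.

Lemma subgroup_add S u v : is_subgroup S -> S u -> S v -> S (u + v).
Proof.
move=> sgS Su Sv; rewrite -[v]opprK.
by apply: sgS.2 Su _; apply: subgroup_opp.
Qed.

Lemma subgroup_mulz S u (a : int) : is_subgroup S -> S u -> S (u *~ a).
Proof.
move=> sgS Su.
have Sn k : S (u *+ k).
  elim: k => [|k IHk]; first exact: sgS.1.
  by rewrite mulrS; apply: subgroup_add.
case: a => k; first by rewrite -pmulrn.
by rewrite NegzE mulrNz -pmulrn; apply: subgroup_opp.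
Qed.

Lemma subgroup_sum S (I : finType) (F : I -> V) :
  is_subgroup S -> (forall i, S (F i)) -> S (\sum_i F i).
Proof.
move=> sgS SF; elim/big_rec: _ => [|i v _ Sv]; first exact: sgS.1.
exact: subgroup_add.
Qed.

Lemma coset_eqP B u v : is_subgroup B ->
  ([set u + b | b in B] = [set v + b | b in B]) <-> B (u - v).
Proof.
move=> sgB; split=> [uv|Buv].
  have : [set v + b | b in B] u.
    by rewrite -uv; exists 0; [exact: sgB.1 | rewrite addr0].
  by case=> b Bb <-; rewrite addrAC subrr add0r.
apply/seteqP; split=> x [b Bb <-].
  exists (u - v + b); first exact: subgroup_add.
  by rewrite addrA [v + _]addrC subrK.
exists (- (u - v) + b); last by rewrite opprB addrA [u + _]addrC subrK.
by apply: subgroup_add => //; apply: subgroup_opp.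
Qed.

(** Cauchy's theorem in the form: a prime divisor of the order of a quotient
divides every exponent of the quotient.  The cosets are transported to
ordinals, on which the group law is computed with representatives, since Z
and B may be infinite. *)
Lemma card_cosets_exponent Z B (N p : nat) (a : int) :
    is_subgroup Z -> is_subgroup B ->
    ([set [set f + b | b in B] | f in Z] #= `I_N)%card ->
    prime p -> (p %| N)%N -> (forall f, Z f -> B (f *~ a)) ->
  (p %| a)%Z.
Proof.
move=> sgZ sgB cardQ p_pr pN aB.
suff [f Zf [nBf Bpf]] : exists2 f, Z f & ~ B f /\ B (f *+ p).
  apply: contra_notT nBf => pa.
  have /eqP cop : coprimez p a by rewrite coprimezE /= prime_coprime.
  have [u [v uv]] := Bezoutz p a.
  have -> : f = f *~ p *~ u + f *~ a *~ v.
    by rewrite -!mulrzA [_ * u]mulrC [_ * v]mulrC -mulrzDr uv cop mulr1z.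
  by apply: subgroup_add => //; apply: subgroup_mulz => //; apply: aB.
have [phi [phi_fun phi_inj phi_surj]] : exists phi, set_bij `I_N
    [set [set f + b | b in B] | f in Z] phi.
  by apply/card_set_bijP; rewrite card_eq_sym.
have /choice[r rP] : forall i : 'I_N, exists f,
    Z f /\ [set f + b | b in B] = phi i.
  by move=> i; have [f Zf <-] := phi_fun i (ltn_ord i); exists f.
have Zr i : Z (r i) by case: (rP i).
have r_inj i j : B (r i - r j) -> i = j.
  move=> /(coset_eqP _ _ sgB); rewrite (rP i).2 (rP j).2 => ij.
  by apply/val_inj/phi_inj; rewrite ?inE //=; apply: mem_set => /=.
have /choice[c cP] : forall f, exists i, Z f -> B (f - r i).
  move=> f; have [Zf|nZf] := pselect (Z f); last first.
    have [i iN _] := phi_surj _ (imageP _ sgZ.1).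
    by exists (Ordinal iN).
  have [i iN phii] := phi_surj _ (imageP _ Zf).
  exists (Ordinal iN) => _; apply/(coset_eqP _ _ sgB).
  by rewrite (rP _).2 phii.
have ZD u v : Z u -> Z v -> Z (u + v) by apply: subgroup_add.
have BD u v : B u -> B v -> B (u + v) by apply: subgroup_add.
have cE f g : Z f -> Z g -> B (f - g) -> c f = c g.
  move=> Zf Zg Bfg; apply: r_inj.
  have -> : r (c f) - r (c g) = (f - g) - (f - r (c f)) + (g - r (c g)).
    rewrite opprB [RHS](AC (2*2*2) ((1*4)*(2*5)*(3*6))) /=.
    by rewrite addrN addNr !add0r.
  by apply: BD; [apply: sgB.2 => // |]; apply: cP.
have cr i : c (r i) = i by apply/esym/r_inj/cP/Zr.
have rc f : Z f -> B (r (c f) - f).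
  by move=> Zf; rewrite -opprB; apply: subgroup_opp => //; apply: cP.
pose add i j := c (r i + r j).
have addl f g : Z f -> Z g -> c (f + r (c g)) = c (f + g).
  move=> Zf Zg; apply: cE; rewrite ?opprD; do ?exact: ZD.
  by rewrite addrACA subrr add0r; apply: rc.
have addC i j : add i j = add j i by rewrite /add addrC.
have addA : associative add.
  move=> i j k; rewrite [in RHS]addC /add !addl //; do ?exact: ZD.
  by rewrite [in RHS]addrC addrA.
have add0 : left_id (c 0) add.
  by move=> i; rewrite addC /add (addl _ _ (Zr i) sgZ.1) addr0 cr.
have addN : left_inverse (c 0) (fun i => c (- r i)) add.
  by move=> i; rewrite addC /add addl ?subrr //; apply: subgroup_opp.
have [|i i0] := group_law_Cauchy addA add0 addN p_pr.
  by rewrite card_ord.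
have Zn k : Z (r i *+ k) by rewrite pmulrn; apply: subgroup_mulz.
have -> : iter p (add i) (c 0) = c (r i *+ p).
  by elim: (p) => [|k IHk]; rewrite //= IHk /add addl // mulrS.
move=> cp; exists (r i); first exact: Zr.
split=> [Bi|].
  by apply: i0; rewrite -[i]cr; apply: cE; rewrite ?subr0 //; apply: sgZ.1.
have Bc := cP _ (Zn p); have Bc0 := rc _ sgZ.1; rewrite -cp subr0 in Bc0.
by rewrite -[_ *+ p](subrK (r (c (r i *+ p)))); apply: BD.
Qed.

End Subgroups.

(** * Central elements of the group ring acting on cohomology *)

Section CentralElements.
Local Open Scope ring_scope.
Local Open Scope classical_set_scope.

Variables (gT : finGroupType) (V : zmodType) (to : {action gT &-> V}).
Hypothesis toD : forall g, {morph to^~ g : u v / u + v}.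

Lemma act_sum (I : finType) (P : pred I) (F : I -> V) g :
  to (\sum_(i | P i) F i) g = \sum_(i | P i) to (F i) g.
Proof.
apply: (big_morph (to^~ g)) => [u v|]; first exact: toD.
by apply: (addrI (to 0 g)); rewrite -toD !addr0.
Qed.

Lemma actN g : {morph to^~ g : u / - u}.
Proof.
move=> u; apply: (addrI (to u g)); rewrite -toD !subrr.
by apply: (addrI (to 0 g)); rewrite -toD !addr0.
Qed.

Lemma d1B : {morph d1 to : u v / u - v}.
Proof.
move=> u v; apply/ffunP => x; rewrite !ffunE toD actN !opprD !opprK.
by rewrite [LHS](AC (2*2*2) ((1*3*5)*(2*4*6))).
Qed.

Lemma d2B : {morph d2 to : u v / u - v}.
Proof.
move=> u v; apply/ffunP => -[[g h] k]; rewrite !ffunE toD actN !opprD !opprK.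
by rewrite [LHS](AC (2*2*2*2) ((1*3*5*7)*(2*4*6*8))).
Qed.

Variable W : set V.
Hypothesis sgW : is_subgroup W.

Lemma Z2_subgroup : is_subgroup (Z2 to W).
Proof.
split=> [|u v [Wu du] [Wv dv]]; split.
- by move=> x; rewrite ffunE; apply: sgW.1.
- by rewrite -[in LHS](subrr 0) d2B subrr.
- by move=> x; rewrite !ffunE; apply: sgW.2.
- by rewrite d2B du dv subrr.
Qed.

Lemma B2_subgroup : is_subgroup (B2 to W).
Proof.
split=> [|u v [f Wf <-] [g Wg <-]].
  exists 0; first by move=> x; rewrite ffunE; apply: sgW.1.
  by rewrite -[in LHS](subrr 0) d1B subrr.
exists (f - g); last exact: d1B.
by move=> x; rewrite !ffunE; apply: sgW.2.
Qed.

Section Homotopy.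
Variables (I : finType) (X : I -> gT).
(* The sum of the X i is central in the group ring: both sides are the values
   of the linear extension of F at the two products with h. *)
Hypothesis X_central : forall (F : gT -> V) h,
  \sum_i F (h * X i)%g = \sum_i F (X i * h)%g.

(** Multiplication by a central element is an endomorphism of the bar
resolution that lifts its augmentation on the trivial module, hence it is
homotopic to it.  For the cocycle f the homotopy is
   b(g) = sum_i f (g, X i) - sum_i f (X i, g):
apply the cocycle identity to (g, h, X i), (g, X i, h) and (X i, g, h), and let
centrality match the middle terms. *)
Lemma central_act_H2 f : Z2 to W f ->
  B2 to W ([ffun x => \sum_i to (f x) (X i)] - f *+ #|I|).
Proof.
move=> [Wf df].
have dE g h k :
    to (f (g, h)) k = f (h, k) - f ((g * h)%g, k) + f (g, (h * k)%g).
  have := congr1 (fun F : {ffun gT * gT * gT -> V} => F (g, h, k)) df.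
  by rewrite !ffunE => /eqP; rewrite subr_eq0 => /eqP.
exists [ffun g => \sum_i f (g, X i) - \sum_i f (X i, g)].
  by move=> g; rewrite ffunE; apply: sgW.2; apply: subgroup_sum.
apply/ffunP => -[g h]; rewrite !ffunE /= toD actN !act_sum.
rewrite (eq_bigr _ (fun i _ => dE g (X i) h)).
rewrite (eq_bigr _ (fun i _ => dE (X i) g h)).
rewrite (eq_bigr _ (fun i _ => dE g h (X i))).
rewrite !(big_split, sumrN) /=.
rewrite ffunMnE sumr_const.
rewrite (X_central (fun z => f (g, z)) h) -(X_central (fun z => f (z, h)) g).
rewrite !opprD !opprK.
(* Three sums occur with both signs and cancel: those of f (X i, h),
   f (X i, g * h) and f (g * X i, h). *)
rewrite [LHS](AC (2*2*(3*3)) (((2*5)*(4*10)*(6*9))*(1*3*7*8))).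
by rewrite /= !addNr addrN !add0r.
Qed.

End Homotopy.
End CentralElements.

(** * The sum of all transpositions acts on a Specht module by a scalar *)

Lemma sumr_mulz (V : zmodType) (I : finType) (P : pred I) (F : I -> V)
    (a : int) :
  ((\sum_(i | P i) F i) *~ a = \sum_(i | P i) F i *~ a)%R.
Proof. exact: (big_morph (fun v => v *~ a)%R (mulrzDl a) (mul0rz V a)). Qed.

Section SpechtCharacter.
Local Open Scope ring_scope.

Variable la : seq nat.
Hypothesis la_part : is_part la.
Let n := sumn la.
Implicit Types (t : tableau la) (T : tabloid la) (s u : 'S_n).

Lemma tabloid_actM T s u :
  tabloid_act T (s * u)%g = tabloid_act (tabloid_act T s) u.
Proof. by apply/val_inj/ffunP => x; rewrite !ffunE invMg permM. Qed.

Lemma permmod_actD s : {morph (permmod_act la)^~ s : v w / v + w}.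
Proof. by move=> v w; apply/ffunP => T; rewrite !ffunE. Qed.

Lemma permmod_actZ s (v : permmod la) (a : int) :
  permmod_act la (v *~ a) s = permmod_act la v s *~ a.
Proof. by apply/ffunP => T; rewrite !(ffunE, ffunMzE). Qed.

Lemma tabloid_vec_act T s :
  permmod_act la (tabloid_vec T) s = tabloid_vec (tabloid_act T s).
Proof.
apply/ffunP => T'; rewrite !ffunE; congr ((_ : bool)%:R).
by apply/eqP/eqP => [<-|->]; rewrite -tabloid_actM ?mulVg ?mulgV;
  apply/val_inj/ffunP => x; rewrite ffunE invg1 perm1.
Qed.

(** The right multiplication of a tabloid by the signed column sum of t; at the
tabloid of t it is the polytabloid. *)
Definition signed_colsum t T : permmod la :=
  \sum_(s | col_stab t s) tabloid_vec (tabloid_act T s) *~ (-1) ^+ s.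

Lemma signed_colsum_act t T u : col_stab t u ->
  signed_colsum t (tabloid_act T u) = signed_colsum t T *~ (-1) ^+ u.
Proof.
move=> tu; rewrite /signed_colsum.
have tuE s : col_stab t (u * s)%g = col_stab t s.
  apply/forallP/forallP => ts x; last first.
    by rewrite permM (eqP (ts _)) (eqP (forallP tu _)).
  have := ts (u^-1 x)%g; rewrite permM permKV => /eqP ->.
  by rewrite -(eqP (forallP tu _)) permKV.
rewrite [RHS]sumr_mulz.
rewrite [RHS](reindex_inj (mulgI u)) /=.
apply: eq_big => [s|s _]; first by rewrite tuE.
rewrite tabloid_actM odd_permM signr_addb -mulrzA mulrC mulrA.
by rewrite -signr_addb addbb mul1r.
Qed.

Lemma tabloid_act1 T : tabloid_act T 1%g = T.
Proof. by apply/val_inj/ffunP => x; rewrite ffunE invg1 perm1. Qed.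

Lemma node_inj (c d : node la) :
  noderow c = noderow d -> nodecol c = nodecol d -> c = d.
Proof.
case: c d => [i a] [j b]; rewrite /noderow /nodecol /= => ij.
by case: _ / ij b => b /val_inj ->.
Qed.

Lemma tabloid_act_tperm T (x y : 'I_n) :
  val T x = val T y -> tabloid_act T (tperm x y) = T.
Proof.
move=> Txy; apply/val_inj/ffunP => z; rewrite ffunE tpermV.
by case: tpermP => // ->.
Qed.

Lemma col_stab_tperm t (x y : 'I_n) :
  nodecol (val t x) = nodecol (val t y) -> col_stab t (tperm x y).
Proof.
by move=> txy; apply/forallP => z; case: tpermP => [->|->|_ _]; rewrite ?txy.
Qed.

Lemma signed_colsum_eq0 t T (x y : 'I_n) : x != y ->
    nodecol (val t x) = nodecol (val t y) -> val T x = val T y ->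
  signed_colsum t T = 0.
Proof.
move=> nxy txy Txy; have := signed_colsum_act T (col_stab_tperm txy).
rewrite tabloid_act_tperm // odd_tperm nxy /= expr1 mulrN1z => v_opp.
apply/ffunP => T'; move/(congr1 (fun v : permmod la => v T')): v_opp.
rewrite [RHS]ffunE => e; rewrite [RHS]ffunE.
by move: {e}(_ T') (e : _ = - _) => z; lia.
Qed.

Lemma tableau_inj t : injective (val t).
Proof. exact/injectiveP/(valP t). Qed.

Lemma tableau_bij t : bijective (val t).
Proof.
by apply: inj_card_bij (@tableau_inj t) _; rewrite card_node card_ord.
Qed.

Lemma tableau_surj t c : exists x, val t x = c.
Proof.
by have [u _ uK] := tableau_bij t; exists (u c).
Qed.

Lemma part_geq (i j : nat) : (i <= j)%N -> (nth 0 la j <= nth 0 la i)%N.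
Proof.
move=> ij; have [lj|] := ltnP j (size la); last by move/(nth_default 0%N) ->.
have /andP[la_sorted _] := la_part.
apply: (sorted_leq_nth _ _ _ la_sorted) => //; rewrite ?inE //.
- by move=> a b c ab bc; apply: leq_trans bc ab.
- by move=> a; apply: leqnn.
- exact: leq_ltn_trans lj.
Qed.

(** The letter z of t in the row of x and the column of y exists because the row
of x is higher, hence at least as long.  Once x and y are exchanged, y and z
share both a row of the tabloid and a column of t, so the column transposition
(y z) fixes the tabloid and reverses the sign of its column sum. *)
Lemma signed_colsum_tperm_lt t (x y : 'I_n) :
    (noderow (val t x) < noderow (val t y))%N ->
    nodecol (val t x) != nodecol (val t y) ->
  signed_colsum t (tabloid_act (tabloid_of t) (tperm x y)) = 0.
Proof.
move=> rxy cxy.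
have col_lt : (nodecol (val t y) < nth 0 la (noderow (val t x)))%N.
  by apply: leq_trans (part_geq (ltnW rxy)); apply: ltn_ord.
have [z tz] := tableau_surj t
  (Tagged (fun i : 'I_(size la) => 'I_(nth 0 la i)) (Ordinal col_lt)).
have rz : noderow (val t z) = noderow (val t x) by rewrite tz.
have cz : nodecol (val t z) = nodecol (val t y) by rewrite tz.
have nzy : z != y.
  by apply/eqP => zy; move: rxy; rewrite -rz zy ltnn.
have nzx : z != x.
  by apply/eqP => zx; move: cxy; rewrite -cz zx eqxx.
apply: (signed_colsum_eq0 nzy cz).
by rewrite !ffunE tpermV tpermR tpermD 1?eq_sym // rz.
Qed.

Lemma signed_colsum_tperm t (x y : 'I_n) :
  signed_colsum t (tabloid_act (tabloid_of t) (tperm x y)) =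
  polytabloid t *~ ((noderow (val t x) == noderow (val t y))%:R
    - ((x != y) && (nodecol (val t x) == nodecol (val t y)))%:R).
Proof.
have [<-|nxy] := eqVneq x y.
  by rewrite tperm1 tabloid_act1 eqxx subr0.
have [rxy|nrxy] := eqVneq (noderow (val t x)) (noderow (val t y)).
  rewrite tabloid_act_tperm ?ffunE //=.
  case: (nodecol _ =P nodecol _) => [cxy|_]; last by rewrite subr0.
  by case/eqP: nxy; apply: (@tableau_inj t); apply: node_inj.
have [cxy|ncxy] := eqVneq (nodecol (val t x)) (nodecol (val t y)).
  by rewrite signed_colsum_act ?col_stab_tperm // odd_tperm nxy.
rewrite subrr mulr0z.
have [rxy|ryx] := leqP (noderow (val t x)) (noderow (val t y)).
  apply: signed_colsum_tperm_lt => //; rewrite ltn_neqAle rxy andbT.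
  by apply: contraNneq nrxy => /val_inj ->.
by rewrite tpermC; apply: signed_colsum_tperm_lt => //; rewrite eq_sym.
Qed.

(** Ordered pairs, the diagonal included, make centrality a reindexing by the
conjugating permutation; the sum is n plus twice the class sum. *)
Lemma sum_tperm_central (V : nmodType) (F : 'S_n -> V) s :
  \sum_(w : 'I_n * 'I_n) F (s * tperm w.1 w.2)%g =
  \sum_(w : 'I_n * 'I_n) F (tperm w.1 w.2 * s)%g.
Proof.
pose h (w : 'I_n * 'I_n) := (s w.1, s w.2).
have h_inj : injective h by move=> [a b] [c d] [/perm_inj -> /perm_inj ->].
rewrite (reindex_inj h_inj); apply: eq_bigr => -[a b] _.
by rewrite /= -tpermJ -conjgC.
Qed.

Lemma sum_node (F : node la -> nat) :
  (\sum_c F c = \sum_(i < size la) \sum_(b < nth 0 la i)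
     F (Tagged (fun i : 'I_(size la) => 'I_(nth 0 la i)) b))%N.
Proof.
rewrite (sig_big_dep (fun i : 'I_(size la) => true)
  (fun (i : 'I_(size la)) (b : 'I_(nth 0 la i)) => true)
  (fun i b => F (Tagged (fun i : 'I_(size la) => 'I_(nth 0 la i)) b))) /=.
by apply: eq_big => // -[i b].
Qed.

(** Each of the rows above that of c is at least as long, hence meets the column
of c in one node. *)
Lemma sum_nodes_above (c : node la) :
  (\sum_(d : node la) ((noderow d < noderow c) && (nodecol c == nodecol d))
   = noderow c)%N.
Proof.
rewrite sum_node; set i := noderow c.
have ci : (nodecol c < nth 0 la i)%N by apply: ltn_ord.
transitivity (\sum_(j < size la) (j < i))%N; last first.
  rewrite -big_mkcond /= (big_ord_narrow (ltnW (ltn_ord i))) /=.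
  by rewrite sum1_card card_ord.
apply: eq_bigr => j _; rewrite /noderow /nodecol /=.
have [ji|_] := ltnP j i; last by rewrite big1.
have cj := leq_trans ci (part_geq (ltnW ji)).
rewrite (bigD1 (Ordinal cj)) //= eqxx big1 // => b.
by rewrite -val_eqE /= eq_sym => /negPf ->.
Qed.

Lemma sum_row_pairs :
  (\sum_(c : node la) \sum_(d : node la) (noderow c == noderow d)
   = \sum_(i < size la) nth 0 la i ^ 2)%N.
Proof.
rewrite sum_node; apply: eq_bigr => i _.
rewrite (eq_bigr (fun=> nth 0 la i)) => [|b _].
  by rewrite sum_nat_const card_ord mulnn.
rewrite -[RHS](card_noderow i) -sum1_card [RHS]big_mkcond /=.
by apply: eq_bigr => d _; rewrite inE eq_sym; case: eqP.
Qed.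

(** Of two distinct nodes in a column one lies above the other, and above a
node of row i there are i nodes; the factor 2 comes from the two orders. *)
Lemma sum_col_pairs :
  (\sum_(c : node la) \sum_(d : node la) ((c != d) && (nodecol c == nodecol d))
   = \sum_(i < size la) 2 * (i * nth 0 la i))%N.
Proof.
transitivity (\sum_(c : node la) \sum_(d : node la)
   (((noderow d < noderow c) && (nodecol c == nodecol d)) +
    ((noderow c < noderow d) && (nodecol d == nodecol c))))%N.
  apply: eq_bigr => c _; apply: eq_bigr => d _.
  rewrite [nodecol d == _]eq_sym.
  case: (nodecol c =P nodecol d) => [cd|_]; last by rewrite !andbF.
  rewrite !andbT; have [->|ncd] := eqVneq c d; first by rewrite ltnn.
  case: ltngtP => // /val_inj rcd.
  by case/eqP: ncd; apply: node_inj.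
under eq_bigr do rewrite big_split /=.
rewrite big_split /= [X in (_ + X)%N]exchange_big /= addnn -mul2n -big_distrr.
congr (2 * _)%N; under eq_bigr do rewrite sum_nodes_above.
rewrite sum_node; apply: eq_bigr => i _.
by rewrite sum_nat_const card_ord mulnC.
Qed.

(** This is n plus twice the sum of the contents of la. *)
Definition transp_char : int :=
  \sum_(i < size la) ((nth 0 la i ^ 2)%:Z - (2 * (i * nth 0 la i))%:Z).

Lemma sum_pairs_tableau t :
  \sum_(w : 'I_n * 'I_n) ((noderow (val t w.1) == noderow (val t w.2))%:R
    - ((w.1 != w.2) && (nodecol (val t w.1) == nodecol (val t w.2)))%:R)
  = transp_char.
Proof.
have [u tK uK] := tableau_bij t.
transitivity (\sum_(w : node la * node la) ((noderow w.1 == noderow w.2)%:Z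
    - ((w.1 != w.2) && (nodecol w.1 == nodecol w.2))%:Z)).
  rewrite [RHS](reindex (fun w : 'I_n * 'I_n => (val t w.1, val t w.2))) /=.
    by apply: eq_bigr => w _; rewrite !natz (inj_eq (@tableau_inj t)).
  by exists (fun w => (u w.1, u w.2)) => -[c d] _ /=; rewrite ?tK ?uK.
rewrite /transp_char [RHS]big_split big_split /= !sumrN.
rewrite -!(big_morph _ PoszD (erefl 0%:Z)).
rewrite -sum_row_pairs -sum_col_pairs.
rewrite (pair_bigA _ (fun c d => nat_of_bool (noderow c == noderow d))).
by rewrite (pair_bigA _ (fun c d =>
  nat_of_bool ((c != d) && (nodecol c == nodecol d)))).
Qed.

(** Centrality moves the transpositions to the left of the column sum, where
they act on the tabloid of t alone. *)
Lemma polytabloid_transp t :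
  \sum_(w : 'I_n * 'I_n) permmod_act la (polytabloid t) (tperm w.1 w.2)
  = polytabloid t *~ transp_char.
Proof.
have actE s :
    permmod_act la (polytabloid t) s =
    \sum_(u | col_stab t u)
      tabloid_vec (tabloid_act (tabloid_of t) (u * s)%g) *~ (-1) ^+ u.
  rewrite (act_sum permmod_actD).
  by apply: eq_bigr => u _; rewrite permmod_actZ tabloid_vec_act tabloid_actM.
rewrite (eq_bigr _ (fun w _ => actE (tperm w.1 w.2))).
rewrite -(sum_pairs_tableau t) (big_morph _ (mulrzDr _) (mulr0z _)).
under [RHS]eq_bigr do rewrite -signed_colsum_tperm.
rewrite /signed_colsum [RHS]exchange_big /=.
rewrite exchange_big /=; apply: eq_bigr => u _.
rewrite -!sumr_mulz; congr (_ *~ _).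
rewrite (sum_tperm_central
  (fun s => tabloid_vec (tabloid_act (tabloid_of t) s)) u).
by apply: eq_bigr => w _; rewrite tabloid_actM.
Qed.

Lemma specht_transp v : specht v ->
  \sum_(w : 'I_n * 'I_n) permmod_act la v (tperm w.1 w.2) = v *~ transp_char.
Proof.
case=> c ->; rewrite sumr_mulz.
have act_comb s : permmod_act la (\sum_t polytabloid t *~ c t) s
    = \sum_t permmod_act la (polytabloid t) s *~ c t.
  rewrite (act_sum permmod_actD).
  by apply: eq_bigr => t _; rewrite permmod_actZ.
rewrite (eq_bigr _ (fun w _ => act_comb (tperm w.1 w.2))).
rewrite exchange_big /=; apply: eq_bigr => t _.
by rewrite -sumr_mulz polytabloid_transp -!mulrzA mulrC.
Qed.

End SpechtCharacter.

(** * The content of the node added along an arrow *)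

Section PrincipalBlock.
Local Open Scope ring_scope.

Lemma specht_subgroup la : is_subgroup (@specht la).
Proof.
split=> [|_ _ [c ->] [d ->]]; first by exists (fun=> 0); rewrite big1.
exists (fun t => c t - d t).
by rewrite -sumrB; apply: eq_bigr => t _; rewrite mulrzBr.
Qed.

Lemma C2_transp_char (p : nat) la : prime p -> C2 p la ->
  (p %| transp_char la - (sumn la ^ 2)%:Z)%Z.
Proof.
move=> p_pr [la_part [N [cardH pN]]].
have actD := @permmod_actD la; have sgS := specht_subgroup la.
apply: (card_cosets_exponent (Z2_subgroup actD sgS) (B2_subgroup actD sgS)
  cardH p_pr pN) => f Zf.
have := central_act_H2 actD sgS (@sum_tperm_central la (permmod la)) Zf.
congr (B2 _ _ _); rewrite card_prod !card_ord mulnn mulrzBr pmulrn.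
congr (_ - _); apply/ffunP => x; rewrite ffunE ffunMzE.
by apply: specht_transp => //; apply: Zf.1.
Qed.

Lemma transp_char_big la k : (size la <= k)%N -> transp_char la =
  \sum_(i < k) ((nth 0 la i ^ 2)%:Z - (2 * (i * nth 0 la i))%:Z).
Proof.
move=> sk; rewrite /transp_char.
rewrite (big_ord_widen k
  (fun i => (nth 0 la i ^ 2)%:Z - (2 * (i * nth 0 la i))%:Z) sk).
rewrite big_mkcond /=; apply: eq_bigr => i _; case: ltnP => // si.
by rewrite nth_default // !muln0.
Qed.

Lemma transp_char_incr la i :
  transp_char (incr_nth la i) =
  transp_char la + (2 * nth 0%N la i + 1)%:Z - (2 * i)%:Z.
Proof.
pose k := maxn (size la) i.+1.
have ik : (i < k)%N by rewrite leq_maxr.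
have sk : (size la <= k)%N by rewrite leq_maxl.
rewrite (transp_char_big sk) (@transp_char_big (incr_nth la i) k); last first.
  by rewrite size_incr_nth; case: ifP.
rewrite (bigD1 (Ordinal ik)) // [in RHS](bigD1 (Ordinal ik)) //=.
rewrite (eq_bigr (fun j : 'I_k =>
  (nth 0 la j ^ 2)%:Z - (2 * (j * nth 0 la j))%:Z)).
  rewrite nth_incr_nth eqxx add1n -!mulnn.
  by move: (nth _ _ _) (\sum_(_ | _) _) => a S; nia.
move=> j; rewrite -val_eqE /= nth_incr_nth eq_sym => /negPf ->.
by rewrite add0n.
Qed.

Lemma sumn_incr_nth la i : sumn (incr_nth la i) = (sumn la).+1.
Proof.
elim: la i => [|a la IHla] [|i] //=; last by rewrite IHla addnS.
by rewrite sumn_ncons mul0n.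
Qed.

Lemma C2_arrow_content (p : nat) la mu :
    prime p -> (2 < p)%N -> C2_arrow p la mu ->
  exists i : nat, [/\ is_part mu, mu = incr_nth la i &
    (p %| (nth 0%N la i)%:Z - i%:Z - (sumn la)%:Z)%Z].
Proof.
move=> p_pr p_gt2 [laC muC [i mu_def]].
exists i; split=> //; first by case: muC.
have := rpredB (C2_transp_char p_pr muC) (C2_transp_char p_pr laC).
rewrite mu_def transp_char_incr sumn_incr_nth.
(* The scalar minus n^2 has changed by twice the content minus n. *)
set d := (_ - _ - _ in X in _ -> X).
rewrite (_ : _ - _ - _ = 2 * d); last by rewrite /d; nia.
rewrite Gauss_dvdzr // coprimezE /= coprimen2.
by case: (even_prime p_pr) p_gt2 => // ->.
Qed.

End PrincipalBlock.

(** * Forced steps *)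

Lemma not_dvdz_rem (p q k : nat) (a : int) : (0 < k < p)%N ->
  a = (- (q * p + k)%:Z)%R -> ~ (p %| a)%Z.
Proof.
move=> /andP[k0 kp] ->; rewrite dvdzE abszN /= dvdn_addr ?dvdn_mull //.
by move/(dvdn_leq k0); rewrite leqNgt kp.
Qed.

(** A node put below the first empty row would leave a part equal to 0, which
bounds the rows to be examined. *)
Lemma is_part_incr_size la i : is_part (incr_nth la i) -> (i <= size la)%N.
Proof.
move=> /andP[_]; apply: contraNT; rewrite -ltnNge => si.
apply/(nthP 0%N); exists (size la); last first.
  by rewrite nth_incr_nth gtn_eqF // nth_default.
by rewrite size_incr_nth (leq_gtF (ltnW si)) ltnW.
Qed.

Section Arrows.
Variable p : nat.
Hypotheses (p_prime : prime p) (p_gt3 : (3 < p)%N).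

Let p_gt2 : (2 < p)%N. Proof. exact: ltnW. Qed.

(** Here n = m p + j - 1, so the added node has content j - 1 modulo p.  The
contents of the nodes to be added in rows 1 to 4 are -2, j - 1, -1 and -3
modulo p, and j < p - 2 separates j - 1 from the other three. *)
Lemma second_row_arrow m j mu : (1 <= m)%N -> (1 <= j)%N -> (j < p - 2)%N ->
  C2_arrow p [:: m * p - 2; j; 1]%N mu -> mu = [:: m * p - 2; j.+1; 1]%N.
Proof.
move=> m1 j1 jp /(C2_arrow_content p_prime p_gt2)[i [mu_part mu_def]].
have := leq_pmull p m1; set mp := (m * p)%N => mp_ge.
move: mu_part; rewrite mu_def => /is_part_incr_size.
case: i {mu_def} => [|[|[|[|//]]]] _ //= dvd.
- by case: (@not_dvdz_rem p 0 j.+1 _ _ _ dvd); lia.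
- by case: (@not_dvdz_rem p m j _ _ _ dvd); rewrite -/mp; lia.
- by case: (@not_dvdz_rem p m j.+2 _ _ _ dvd); rewrite -/mp; lia.
Qed.

(** Here n = 2 p - 3: only the content -3 of the new fourth row is n modulo p,
and the second row is already as long as the first. *)
Lemma fourth_row_arrow mu :
  C2_arrow p [:: p - 2; p - 2; 1] mu ->
  mu = [:: p - 2; p - 2; 1; 1].
Proof.
move=> /(C2_arrow_content p_prime p_gt2)[i [mu_part mu_def]].
have := is_part_incr_size; move/(_ [:: p - 2; p - 2; 1]%N i).
move: mu_part; rewrite mu_def => mu_part /(_ mu_part).
case: i mu_part {mu_def} => [|[|[|[|//]]]] //= mu_part _ dvd.
- by case: (@not_dvdz_rem p 0 p.-1 _ _ _ dvd); lia.
- by case/andP: mu_part => /=; rewrite /geq /= ltnn.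
- by case: (@not_dvdz_rem p 1 (p - 2) _ _ _ dvd); lia.
Qed.

(** Here n = 2 p - 2: the content p - 2 in the first row is n modulo p. *)
Lemma first_row_arrow mu :
  C2_arrow p [:: p - 2; p - 2; 1; 1] mu ->
  mu = [:: p - 1; p - 2; 1; 1].
Proof.
move=> /(C2_arrow_content p_prime p_gt2)[i [mu_part mu_def]].
have := is_part_incr_size; move/(_ [:: p - 2; p - 2; 1; 1]%N i).
move: mu_part; rewrite mu_def => mu_part /(_ mu_part).
case: i mu_part {mu_def} => [|[|[|[|[|//]]]]] //= mu_part _ dvd.
- by congr (_ :: _); lia.
- by case/andP: mu_part => /=; rewrite /geq /= ltnn.
- by case: (@not_dvdz_rem p 1 p.-1 _ _ _ dvd); lia.
- by case/andP: mu_part => /=; rewrite /geq /= !andbF.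
- by case: (@not_dvdz_rem p 2 2 _ _ _ dvd); lia.
Qed.

Lemma C2_path_second_row m (q : nat -> seq nat) : (1 <= m)%N ->
    C2_path p q -> q 0 = [:: m * p - 2; 1; 1]%N ->
  forall j, (1 <= j <= p - 2)%N -> q (j - 1)%N = [:: m * p - 2; j; 1]%N.
Proof.
move=> m1 [q_arrow _ _] q0; elim=> [|[|j] IHj] // /andP[_ jp].
have qj : q j = [:: m * p - 2; j.+1; 1]%N.
  by have := IHj; rewrite subn1; apply; rewrite /= ltnW.
by rewrite subn1; apply: second_row_arrow => //; rewrite -qj.
Qed.

End Arrows.

Theorem lemma6p3 (p m : nat) (p_prime : prime p) (p_gt3 : 3 < p)
    (m_ge1 : 1 <= m) :
  (forall q : nat -> seq nat,
      C2_path p q -> q 0 = [:: m * p - 2; 1; 1] ->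
      forall j, 1 <= j <= p - 2 -> q (j - 1) = [:: m * p - 2; j; 1])
  /\
  (m = 1 ->
   forall q : nat -> seq nat,
      C2_path p q -> q 0 = [:: p - 2; 1; 1] ->
      [/\ forall j, 1 <= j <= p - 2 -> q (j - 1) = [:: p - 2; j; 1],
          q (p - 2) = [:: p - 2; p - 2; 1; 1]
        & q (p - 1) = [:: p - 1; p - 2; 1; 1]]).
Proof.
split=> [q|_ q qP q0]; first exact: C2_path_second_row.
have q_hook j : 1 <= j <= p - 2 -> q (j - 1) = [:: p - 2; j; 1].
  have := @C2_path_second_row p p_prime p_gt3 1 q isT qP.
  by rewrite mul1n; apply.
have [q_arrow _ _] := qP.
have q_last : q (p - 2) = [:: p - 2; p - 2; 1; 1].
  have := q_arrow (p - 2 - 1); rewrite (q_hook (p - 2)); last by lia.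
  have -> : (p - 2 - 1).+1 = p - 2 by lia.
  exact: fourth_row_arrow.
split=> //; have := q_arrow (p - 2); rewrite q_last.
have -> : (p - 2).+1 = p - 1 by lia.
exact: first_row_arrow.
Qed.
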